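(* Let $d,m\ge1$ and let $B=(b^{(1)},\dots,b^{(m)})$ be a labelled configuration of points in $[0,\infty)^d$ lying in a differentiability chamber, i.e. in an open subset of $(\mathbb R^d)^m$ contained in $([0,\infty)^d)^m$ on which, for every nonempty $S\subseteq\{1,\dots,d\}$, the shadow hypervolume $\mathrm{HV}_S$ is differentiable at the projected configuration $P_SB$ as a function of the coordinates of the $m$ projected points. Then for every $i\in\{1,\dots,m\}$, $$\nabla_{b^{(i)}}\mathrm{Mag}_d(D(B))=\sum_{\varnothing\ne S\subseteq\{1,\dots,d\}}2^{-|S|}\,P_S^{\top}\,\nabla_{P_Sb^{(i)}}\mathrm{HV}_S(P_SB).$$
   Context: For nonempty $S\subseteq\{1,\dots,d\}$, $P_S:\mathbb R^d\to\mathbb R^{|S|}$ is the coordinate projection onto the coordinates in $S$, $P_SB:=(P_Sb^{(1)},\dots,P_Sb^{(m)})$ is the shadow of $B$, and $P_S^\top:\mathbb R^{|S|}\to\mathbb R^d$ is the adjoint insertion map (it places the given components in the coordinates in $S$ and fills the others with zeros). $\mathrm{HV}_S(P_SB)$ is the origin-anchored hypervolume of the shadow, i.e. the $|S|$-dimensional Lebesgue measure of $\bigcup_{i=1}^m\prod_{j\in S}[0,b^{(i)}_j]$. $D(B):=\bigcup_{i=1}^m\prod_{j=1}^d[0,b^{(i)}_j]$ is the origin-anchored dominated set, and its ($\ell_1$-)magnitude is given by $$\mathrm{Mag}_d(D(B))=1+\sum_{\varnothing\ne S\subseteq\{1,\dots,d\}}2^{-|S|}\,\mathrm{HV}_S(P_SB),$$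 which is taken here as its definition. $\nabla_{b^{(i)}}$ is the gradient with respect to the $d$ coordinates of $b^{(i)}$, and $\nabla_{P_Sb^{(i)}}$ the gradient with respect to the $|S|$ coordinates of the $i$-th projected point. *)

(* Defs.v *)
From HB Require Import structures.
From mathcomp Require Import all_boot all_order all_algebra.
From mathcomp Require Import all_classical all_reals all_analysis.

Set Implicit Arguments.
Unset Strict Implicit.
Unset Printing Implicit Defensive.
Import Order.TTheory GRing.Theory Num.Theory.
Import numFieldNormedType.Exports.
Local Open Scope classical_set_scope.
Local Open Scope ring_scope.

(* Lebesgue measure on R^n, the n-fold product of the Lebesgue measure of the
   line transported to n-tuples; R^0 is a point, of measure 1. *)
Section lebesgue_measure_tuple.
Context {R : realType}.

Definition cons_tuple {n} (p : measurableTypeR R * n.-tuple (measurableTypeR R)) :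
  n.+1.-tuple (measurableTypeR R) := [tuple of p.1 :: p.2].

Fixpoint lebesgue_measure_tuple n :
    set (n.-tuple (measurableTypeR R)) -> \bar R :=
  match n with
  | 0 => \d_([tuple] : 0.-tuple (measurableTypeR R))
  | n.+1 => pushforward
      (lebesgue_measure \x @lebesgue_measure_tuple n)%E cons_tuple
  end.

Lemma measurable_cons_tuple n :
  measurable_fun [set: measurableTypeR R * n.-tuple (measurableTypeR R)]
    cons_tuple.
Proof.
by apply: measurable_cons; [exact: measurable_fst|exact: measurable_snd].
Qed.

Definition uncons_tuple {n} (x : n.+1.-tuple (measurableTypeR R)) :
  measurableTypeR R * n.-tuple (measurableTypeR R) :=
  (thead x, [tuple of behead x]).

Lemma measurable_uncons_tuple n :
  measurable_fun [set: n.+1.-tuple (measurableTypeR R)] uncons_tuple.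
Proof.
by apply/measurable_fun_pair; [exact: measurable_tnth|exact: measurable_behead].
Qed.

Lemma uncons_tupleK n
    (A : set (measurableTypeR R * n.-tuple (measurableTypeR R))) :
  cons_tuple @^-1` (uncons_tuple @^-1` A) = A.
Proof.
apply/seteqP; split => -[x t]; rewrite /= /uncons_tuple theadE/=;
  by congr A; congr pair; apply/val_inj.
Qed.

Lemma lebesgue_measure_tuple_sigma_finite_measure n :
  exists mu :
      {sigma_finite_measure set (n.-tuple (measurableTypeR R)) -> \bar R},
    @lebesgue_measure_tuple n = mu.
Proof.
elim: n => [|n [mu IH]].
  by exists (dirac ([tuple] : 0.-tuple (measurableTypeR R))).
pose nu : {measure set _ -> \bar R} :=
  measure_function_pushforward__canonical__measure_function_Measure
    (lebesgue_measure \x mu)%E (@measurable_cons_tuple n).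
have snu : sigma_finite setT nu.
  have /sigma_finiteP[F [TF ndF Foo]] := sigma_finiteT (@lebesgue_measure R).
  have /sigma_finiteP[G [TG ndG Goo]] := sigma_finiteT mu.
  exists (fun k => uncons_tuple @^-1` (F k `*` G k)).
    rewrite -preimage_bigcup -[LHS](preimage_setT uncons_tuple); congr preimage.
    apply/seteqP; split => -[x t] //= _.
    have [k _ Fk] : (\bigcup_i F i) x by rewrite -TF.
    have [l _ Gl] : (\bigcup_i G i) t by rewrite -TG.
    exists (maxn k l) => //; split => /=.
      by move: Fk; apply/subsetPset/ndF/leq_maxl.
    by move: Gl; apply/subsetPset/ndG/leq_maxr.
  move=> k; have [mF Fk] := Foo k; have [mG Gk] := Goo k; split.
    rewrite -[X in measurable X]setTI; apply: measurable_uncons_tuple => //.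
    exact: measurableX.
  rewrite /nu /= /pushforward uncons_tupleK product_measure1E//.
  by rewrite lte_mul_pinfty// ge0_fin_numE.
pose H := Measure_isSigmaFinite.Build _ _ _ nu snu.
pose nu' := HB.pack_for (SigmaFiniteMeasure.type _ R) (Measure.sort nu) H.
by exists nu'; rewrite /= IH.
Qed.

Lemma lebesgue_measure_tuple_box n (A : 'I_n -> set (measurableTypeR R)) :
  (forall j, measurable (A j)) ->
  lebesgue_measure_tuple [set x : n.-tuple _ | forall j, A j (tnth x j)] =
  (\prod_(j < n) lebesgue_measure (A j))%E.
Proof.
elim: n A => [|n IH] A mA.
  by rewrite big_ord0 /= diracE mem_set//= => -[].
have [mu muE] := lebesgue_measure_tuple_sigma_finite_measure n.
rewrite big_ord_recl -IH// /= /pushforward muE -product_measure1E//; last first.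
  rewrite (_ : [set x | _] = \bigcap_j (fun x : n.-tuple _ => tnth x j) @^-1`
      (fun j : 'I_n => A (lift ord0 j)) j).
    apply: fin_bigcap_measurable => // j _.
    by rewrite -[X in measurable X]setTI; exact: measurable_tnth.
  by apply/seteqP; split => [x + j _|x + j]; apply.
congr product_measure1; apply/seteqP; split => -[x t] /=.
  move=> xt; split; first exact: (xt ord0).
  by move=> j; have := xt (lift ord0 j); rewrite tnthS.
move=> [x0 tj] j.
have [->//|j0] := eqVneq j ord0.
have [k ->] : exists k, j = lift ord0 k.
  by case: (unliftP ord0 j) j0 => [k ->|->]; [exists k|rewrite eqxx].
by rewrite tnthS.
Qed.

End lebesgue_measure_tuple.

(* A configuration of m points of R^n is an m x n matrix: the i-th point is the
   i-th row. *)
Section configuration.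
Context {R : realType} {m n : nat}.

(* [hypervolume] is total on R^(m x n): a point with a negative coordinate
   dominates nothing. *)
Definition dominated_set (C : 'M[R]_(m, n)) :
    set (n.-tuple (measurableTypeR R)) :=
  \bigcup_(i : 'I_m) [set x | forall j, 0 <= tnth x j <= C i j].

Definition hypervolume (C : 'M[R]_(m, n)) : R :=
  fine (lebesgue_measure_tuple (dominated_set C)).

Lemma box_itvE (a : 'I_n -> R) :
  [set x : n.-tuple (measurableTypeR R) | forall j, 0 <= tnth x j <= a j] =
  [set x | forall j, `[0, a j]%classic (tnth x j)].
Proof.
by apply/seteqP; split => x /= + j => /(_ j); rewrite in_itv.
Qed.

Lemma measurable_box (a : 'I_n -> R) : measurable
  [set x : n.-tuple (measurableTypeR R) | forall j, 0 <= tnth x j <= a j].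
Proof.
rewrite box_itvE (_ : [set x | _] = \bigcap_j
    ((fun x : n.-tuple _ => tnth x j) @^-1` `[0, a j]%classic)).
  apply: fin_bigcap_measurable => // j _.
  by rewrite -[X in measurable X]setTI; exact: measurable_tnth.
by apply/seteqP; split => [x + j _|x + j]; apply.
Qed.

Lemma measurable_dominated_set (C : 'M[R]_(m, n)) : measurable (dominated_set C).
Proof. by apply: fin_bigcup_measurable => // i _; exact: measurable_box. Qed.

Lemma dominated_set_fin_num (C : 'M[R]_(m, n)) :
  lebesgue_measure_tuple (dominated_set C) \is a fin_num.
Proof.
have [mu muE] := @lebesgue_measure_tuple_sigma_finite_measure R n.
rewrite muE ge0_fin_numE//.
pose a j := \sum_(i < m) `|C i j|.
apply: (@le_lt_trans _ _ (mu [set x | forall j, 0 <= tnth x j <= a j])).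
  apply: le_measure; rewrite ?inE.
  - exact: measurable_dominated_set.
  - exact: measurable_box.
  - move=> x [i _] /= xC j; have /andP[-> /le_trans] /= := xC j; apply.
    rewrite (le_trans (ler_norm _))// /a (bigD1 i)//= lerDl.
    by apply: sumr_ge0 => *.
rewrite -muE box_itvE.
rewrite (lebesgue_measure_tuple_box (A := fun j => `[0, a j]%classic))//.
rewrite -ge0_fin_numE; last by apply: prode_ge0 => j _; exact: measure_ge0.
elim/big_rec : _ => // j x _ xfin; rewrite fin_numM//.
by rewrite lebesgue_measure_itv/=; case: ifP.
Qed.

(* The gradient with respect to the coordinates of the i-th point is that of the
   function obtained by freezing the other points. *)
Definition set_point (i : 'I_m) (C : 'M[R]_(m, n)) (x : 'rV[R]_n) :
    'M[R]_(m, n) :=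
  \matrix_(k, j) if k == i then x 0 j else C k j.

Definition gradient (f : 'rV[R]_n -> R) (x : 'rV[R]_n) : 'rV[R]_n :=
  \row_j 'D_(delta_mx 0 j) f x.

Definition gradient_pt (i : 'I_m) (f : 'M[R]_(m, n) -> R) (C : 'M[R]_(m, n)) :
    'rV[R]_n :=
  gradient (f \o set_point i C) (row i C).

End configuration.

Section shadows.
Context {R : realType} {m d : nat}.
Implicit Types S : {set 'I_d}.

(* The coordinates in S are numbered increasingly by [enum_val : 'I_#|S| -> 'I_d]. *)
Definition proj S (v : 'rV[R]_d) : 'rV[R]_#|S| := \row_j v 0 (enum_val j).

Definition shadow S (B : 'M[R]_(m, d)) : 'M[R]_(m, #|S|) :=
  \matrix_i proj S (row i B).

Definition insertion S (w : 'rV[R]_#|S|) : 'rV[R]_d :=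
  \row_k if [pick j | enum_val j == k] is Some j then w 0 j else 0.

Lemma insertion_enum_val S (w : 'rV[R]_#|S|) j :
  insertion w 0 (enum_val j) = w 0 j.
Proof.
rewrite mxE; case: pickP => [k /eqP/enum_val_inj->//|/(_ j)].
by rewrite eqxx.
Qed.

Lemma insertion_notin S (w : 'rV[R]_#|S|) k : k \notin S -> insertion w 0 k = 0.
Proof.
by rewrite mxE; case: pickP => // j /eqP<-; rewrite enum_valP.
Qed.

Lemma insertion_adjoint S (v : 'rV[R]_d) (w : 'rV[R]_#|S|) :
  proj S v *m w^T = v *m (insertion w)^T.
Proof.
apply/matrixP => i k; rewrite !ord1 !mxE [RHS](bigID (fun l => l \in S))/=.
rewrite [X in _ = _ + X]big1 ?addr0; last first.
  by move=> l lS; rewrite [X in _ * X]mxE insertion_notin ?mulr0.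
rewrite [RHS]big_enum_val; apply: eq_bigr => j _.
by rewrite [in RHS]mxE insertion_enum_val !mxE.
Qed.

(* The l1-magnitude of [dominated_set B], given by its expansion over shadows. *)
Definition magnitude (B : 'M[R]_(m, d)) : R :=
  1 + \sum_(S : {set 'I_d} | S != finset.set0)
        2 ^- #|S| * hypervolume (shadow S B).

Definition differentiability_chamber (U : set 'M[R]_(m, d)) : Prop :=
  [/\ open U,
      U `<=` [set C | forall i j, 0 <= C i j] &
      forall C, U C -> forall S, S != finset.set0 ->
        differentiable (hypervolume : 'M[R]_(m, #|S|) -> R) (shadow S C)].

End shadows.

(* Main.v *)
From HB Require Import structures.
Require Import Defs.
From mathcomp Require Import all_boot all_order all_algebra.
From mathcomp Require Import all_classical all_reals all_analysis.

Set Implicit Arguments.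
Unset Strict Implicit.
Unset Printing Implicit Defensive.
Import Order.TTheory GRing.Theory Num.Theory.
Import numFieldNormedType.Exports.
Local Open Scope classical_set_scope.
Local Open Scope ring_scope.

(* Moving the i-th point of B moves the i-th point of its shadow on S by P_S, so
   the S-term of the magnitude is HV_S composed with an affine map; the chain rule
   and the adjointness of P_S and its insertion give the S-term of the gradient. *)

Lemma is_diff_sum (R : numFieldType) (V W : normedModType R) (I : Type)
    (r : seq I) (P : pred I) (f df : I -> V -> W) (x : V) :
  (forall i, P i -> is_diff x (f i) (df i)) ->
  is_diff x (\sum_(i <- r | P i) f i) (\sum_(i <- r | P i) df i).
Proof.
move=> fdf; elim/big_ind2 : _ => //; first exact: is_diff_cst.
by move=> f1 df1 f2 df2 ? ?; exact: is_diffD.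
Qed.

Lemma gradientE (R : realType) (n : nat) (f df : 'rV[R]_n -> R) (x : 'rV[R]_n) :
  is_diff x f df -> gradient f x = \row_j df (delta_mx 0 j).
Proof.
by move=> fdf; apply/rowP => j; rewrite !mxE deriveE ?diff_val//; exact: ex_diff.
Qed.

Section set_point_reindexing.
Context {R : realType} {m n d : nat}.
Variables (i : 'I_m) (h : 'I_n -> 'I_d).

(** Freezing the other points at 0 keeps only the linear part of the affine map that moves the i-th
    point. *)
Let L (v : 'rV[R]_d) : 'M[R]_(m, n) := set_point i 0 (\row_j v 0 (h j)).

Let L_linear : linear L.
Proof.
move=> a u v; apply/matrixP => k j; rewrite !mxE.
by case: ifP => _; rewrite ?mulr0 ?addr0.
Qed.

Let L_continuous : continuous L.
Proof.
move=> x; apply/(@cvg_ballP _ _ _ _ (nbhs_filter x)) => e e0.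
(* Balls are entrywise and each entry of [L y] is a coordinate of [y] or 0, so the same radius
   works. *)
apply: filterS (nbhsx_ballx x e e0) => y [_ xy]; split => // k j; rewrite !mxE.
by case: ifP => _; [exact: xy|exact: ballxx].
Qed.

(** The map is a constant plus [L]. With [h] the identity it serves the gradient in the projected
    point; with [h] equal to [enum_val] the reindexing is the projection onto S. *)
Lemma is_diff_set_point_reindex (C : 'M[R]_(m, n)) (x : 'rV[R]_d) :
  is_diff x (fun y => set_point i C (\row_j y 0 (h j)))
    (fun v => set_point i 0 (\row_j v 0 (h j))).
Proof.
pose LM := GRing.isLinear.Build _ _ _ _ _ L_linear.
pose Ll : {linear _ -> _} := HB.pack L LM.
have -> : (fun y : 'rV[R]_d => set_point i C (\row_j y 0 (h j))) =
    cst (set_point i C 0) + L.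
  apply/funext => y; apply/matrixP => k j; rewrite !mxE.
  by case: ifP => _; rewrite ?addr0 ?add0r.
have dL : is_diff x L L.
  apply: DiffDef; first exact: (@linear_differentiable _ _ _ Ll).
  exact: (@diff_lin _ _ _ Ll).
by apply: is_diff_eq; rewrite add0r.
Qed.

End set_point_reindexing.

(** Expanding [w] in the standard basis writes the form as a pairing with a row vector, the shape to
    which [insertion_adjoint] applies. *)
Lemma linear_set_point (R : realType) (m n : nat) (i : 'I_m)
    (phi : {linear 'M[R]_(m, n) -> R}) (w : 'rV[R]_n) :
  phi (set_point i 0 w) =
    (w *m (\row_j phi (set_point i 0 (delta_mx 0 j)))^T) 0 0.
Proof.
have -> : set_point i 0 w =
    \sum_j w 0 j *: set_point i (0 : 'M[R]_(m, n)) (delta_mx 0 j).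
  apply/matrixP => k l; rewrite summxE mxE.
  under eq_bigr do rewrite !mxE.
  case: ifP => _; last by rewrite big1 ?mxE// => j _; rewrite mulr0.
  rewrite (bigD1 l)//= !eqxx mulr1 big1 ?addr0// => j jl.
  by rewrite eq_sym (negbTE jl) mulr0.
rewrite [RHS]mxE raddf_sum; apply: eq_bigr => j _.
by rewrite [LHS]linearZ !mxE.
Qed.

Section shadow_gradient.
Context {R : realType} {m d : nat}.
Variables (i : 'I_m) (B : 'M[R]_(m, d)) (S : {set 'I_d}).

Lemma set_point_row n (C : 'M[R]_(m, n)) : set_point i C (row i C) = C.
Proof. by apply/matrixP => k j; rewrite !mxE; case: eqP => // ->. Qed.

Lemma shadow_set_point (x : 'rV[R]_d) :
  shadow S (set_point i B x) = set_point i (shadow S B) (Defs.proj S x).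
Proof. by apply/matrixP => k j; rewrite !mxE; case: ifP => _; rewrite ?mxE. Qed.

Lemma row_shadow : row i (shadow S B) = Defs.proj S (row i B).
Proof. by apply/rowP => j; rewrite !mxE. Qed.

Lemma is_diff_shadow (g : 'M[R]_(m, #|S|) -> R) :
  differentiable g (shadow S B) ->
  is_diff (row i B) (g \o shadow S \o set_point i B)
    (fun v => (v *m (insertion (gradient_pt i g (shadow S B)))^T) 0 0).
Proof.
move=> dg; have BE := set_point_row (shadow S B).
(* The chain rule needs [g] differentiable at the image of the inner map; putting its own i-th row
   back into the shadow changes nothing. *)
have dgE : is_diff (set_point i (shadow S B) (row i (shadow S B))) g
    ('d g (shadow S B)).
  by rewrite BE; apply: differentiableP.
have -> : gradient_pt i g (shadow S B) =
    \row_j 'd g (shadow S B) (set_point i 0 (delta_mx 0 j)).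
  apply: (gradientE (df := 'd g (shadow S B) \o set_point i 0)).
  apply: is_diff_comp.
  have idE (C : 'M[R]_(m, #|S|)) :
      (fun y : 'rV_#|S| => set_point i C (\row_j y 0 (id j))) = set_point i C.
    by apply/funext => y; apply/matrixP => k j; rewrite !mxE.
  by rewrite -(idE (shadow S B)) -(idE 0); exact: is_diff_set_point_reindex.
have -> : g \o shadow S \o set_point i B =
    g \o (set_point i (shadow S B) \o Defs.proj S).
  by apply/funext => x /=; rewrite shadow_set_point.
rewrite row_shadow in dgE.
apply: is_diff_eq (is_diff_comp (is_diff_set_point_reindex _ _ _ _) dgE) _.
apply/funext => v /=.
(* Adjointness turns the pairing of [v] with the inserted gradient into that of the projection of
   [v] with the gradient itself. *)
by rewrite -insertion_adjoint; exact: (linear_set_point i ('d g (shadow S B))).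
Qed.

End shadow_gradient.

Theorem mainTheorem5 (R : realType) (d m : nat) (d_ge1 : (1 <= d)%N)
    (m_ge1 : (1 <= m)%N) (U : set 'M[R]_(m, d))
    (chamberU : differentiability_chamber U) (B : 'M[R]_(m, d)) (UB : U B)
    (i : 'I_m) :
  differentiable (magnitude \o set_point i B) (row i B) /\
  gradient_pt i magnitude B =
    \sum_(S : {set 'I_d} | S != finset.set0)
      2 ^- #|S| *: insertion (gradient_pt i hypervolume (shadow S B)).
Proof.
have [_ _ /(_ _ UB) dHV] := chamberU.
pose G S := insertion (gradient_pt i (@hypervolume R m _) (shadow S B)).
(* As an identity between functions, this lets the differential be computed term by term. *)
have magE : magnitude \o set_point i B = cst 1 +
    \sum_(S : {set 'I_d} | S != finset.set0)
      2 ^- #|S| *: (hypervolume \o shadow S \o set_point i B).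
  by apply/funext => x; rewrite /= /magnitude fctE fct_sumE.
have dmag : is_diff (row i B) (magnitude \o set_point i B)
    (0 + \sum_(S : {set 'I_d} | S != finset.set0)
      2 ^- #|S| *: (fun v => (v *m (G S)^T) 0 0)).
  rewrite magE; apply: is_diffD.
  apply: is_diff_sum => S S0; apply: is_diffZ.
  by apply: is_diff_shadow; exact: dHV.
(* ['D] is a limit with a default value where none exists; differentiability makes [gradient_pt] a
   true gradient here. *)
split; first exact: ex_diff.
rewrite /gradient_pt (gradientE dmag); apply/rowP => k.
rewrite !mxE fctE add0r fct_sumE summxE; apply: eq_bigr => S _.
rewrite [RHS]mxE -/(G S); congr (_ * _).
(* Pairing the k-th basis vector with [G S] picks out its k-th coordinate. *)
by rewrite -rowE !mxE.
Qed.
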